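(* For flows $X$ and $Y$ let $\mathbf{FLOW}(X,Y)$ be the set of morphisms of flows from $X$ to $Y$ equipped with the Kelleyfication of the compact-open topology. Then the mapping $(X,Y)\mapsto \mathbf{FLOW}(X,Y)$ induces a functor from $\mathbf{Flow}\times\mathbf{Flow}$ to $\mathbf{Top}$ which is contravariant with respect to $X$ and covariant with respect to $Y$. Moreover: (1) One has the natural homeomorphism $\mathbf{FLOW}(\varinjlim_i X_i,Y)\cong \varprojlim_i \mathbf{FLOW}(X_i,Y)$ for any colimit $\varinjlim_i X_i$ in $\mathbf{Flow}$. (2) One has the natural homeomorphism $\mathbf{FLOW}(X,\varprojlim_i Y_i)\cong \varprojlim_i\mathbf{FLOW}(X, Y_i)$ for any finite limit $\varprojlim_i Y_i$ in $\mathbf{Flow}$.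
   Context: $\mathbf{Top}$ is the category of compactly generated spaces (weak Hausdorff $k$-spaces) and continuous maps; all spaces are in $\mathbf{Top}$, and products and limits are taken in $\mathbf{Top}$. The Kelleyfication functor is the right adjoint of the inclusion of $k$-spaces into general topological spaces. A flow $X$ consists of a space $\mathbb{P}X$ (path space), a discrete space $X^0$ ($0$-skeleton), continuous maps $s,t:\mathbb{P}X\to X^0$, and a continuous associative map $*:\{(x,y)\in \mathbb{P}X\times\mathbb{P}X;\ t(x)=s(y)\}\to\mathbb{P}X$ with $s(x*y)=s(x)$, $t(x*y)=t(y)$ (no identities are required). A morphism of flows $f:X\to Y$ is a set map $f^0:X^0\to Y^0$ together with a continuous map $\mathbb{P}f:\mathbb{P}X\to\mathbb{P}Y$ commuting with $s$, $t$ and $*$. The category is $\mathbf{Flow}$ (it is complete and cocomplete). The underlying space of $X$ is $X^0\sqcup\mathbb{P}X$, and morphisms of flows are regarded as continuous maps between underlying spaces, which gives the compact-open topology on the set of morphisms. Colimits and limits are over small diagrams. *)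

(* Defs.v *)
From HB Require Import structures.
From mathcomp Require Import all_boot finmap all_classical.
From mathcomp Require Import topology.
Set Implicit Arguments.
Unset Strict Implicit.
Unset Printing Implicit Defensive.
Local Open Scope classical_set_scope.


Definition k_open (T : topologicalType) (A : set T) : Prop :=
  forall (K : topologicalType) (f : K -> T),
    compact [set: K] -> hausdorff_space K -> continuous f -> open (f @^-1` A).

Definition k_space (T : topologicalType) : Prop :=
  forall A : set T, k_open A -> open A.

Definition weak_hausdorff (T : topologicalType) : Prop :=
  forall (K : topologicalType) (f : K -> T),
    compact [set: K] -> hausdorff_space K -> continuous f -> closed (range f).

Definition compactly_generated (T : topologicalType) : Prop :=
  k_space T /\ weak_hausdorff T.

Definition kelley (T : topologicalType) : Type := T.

Section Kelley.
Variable T : topologicalType.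

Let k_openT : @k_open T setT.
Proof. by move=> K f _ _ _; rewrite preimage_setT; exact: openT. Qed.

Let k_openI : setI_closed (@k_open T).
Proof.
move=> A B kA kB K f cK hK cf; rewrite preimage_setI.
by apply: openI; [exact: kA|exact: kB].
Qed.

Let k_open_bigU (I : Type) (g : I -> set T) :
  (forall i, k_open (g i)) -> k_open (\bigcup_i g i).
Proof.
move=> kg K f cK hK cf; rewrite preimage_bigcup.
by apply: bigcup_open => i _; exact: kg.
Qed.

HB.instance Definition _ := Choice.on (kelley T).
HB.instance Definition _ :=
  isOpenTopological.Build (kelley T) k_openT k_openI k_open_bigU.

Lemma kelley_openE (A : set (kelley T)) : open A = @k_open T A.
Proof. by []. Qed.

Lemma kelley_continuous (Z : topologicalType) (f : Z -> kelley T) :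
  k_space Z -> continuous f <-> continuous (f : Z -> T).
Proof.
move=> kZ; split=> /continuousP cf; apply/continuousP => A oA.
  by apply: cf; rewrite kelley_openE => K g _ _ /continuousP; exact.
apply: kZ => K g cK hK cg; have := cf A; rewrite kelley_openE in oA.
move=> _; apply: (oA K (f \o g)) => // x.
by apply: continuous_comp; [exact: cg|move: (g x); apply/continuousP].
Qed.

End Kelley.

Definition homeomorphism (S T : topologicalType) (f : S -> T) : Prop :=
  continuous f /\
  exists g : T -> S, [/\ continuous g, cancel f g & cancel g f].

(* Limits of compactly generated spaces are the Kelleyfications of the limits  *)
(* of general spaces; see top_lim_universal for the universal property.  The   *)
(* composites and identities of the indexing category do not matter for the    *)
(* set of compatible families, so only its arrows E appear.                    *)
Section Limit.
Variables (I : Type) (E : I -> I -> Type) (S : I -> topologicalType).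
Variable S_ : forall i j, E i j -> S i -> S j.

Definition compatible : set (prod_topology S) :=
  [set x | forall i j (e : E i j), S_ e (x i) = x j].

Definition top_lim : topologicalType := kelley (set_type compatible).

Definition mk_lim (x : prod_topology S) (h : compatible x) : top_lim :=
  exist _ x (mem_set h).

Definition coord (x : top_lim) : forall i, S i :=
  set_val (x : set_type compatible).

Lemma coord_compatible (x : top_lim) i j (e : E i j) :
  S_ e (coord x i) = coord x j.
Proof. exact: (set_mem (valP (x : set_type compatible))). Qed.

Lemma coord_continuous i : continuous (coord^~ i : top_lim -> S i).
Proof.
apply/continuousP => A oA; rewrite kelley_openE => K f _ _ /continuousP.
apply; exists [set x : prod_topology S | A (x i)] => //.
pose B := [set x : prod_topology S | A (x i)].
exists [set B]; last by rewrite bigcup_set1.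
move=> _ ->; exists (fset1 B) => //; last by rewrite set_fset1 bigcap_set1.
by move=> _ /[!inE] ->; exists i => //; exists A.
Qed.

Lemma coord_inj (x y : top_lim) : coord x = coord y -> x = y.
Proof. by move=> xy; exact: val_inj. Qed.

Lemma top_lim_universal (Z : topologicalType) (f : forall i, Z -> S i) :
  k_space Z -> (forall i, continuous (f i)) ->
  (forall i j (e : E i j) z, S_ e (f i z) = f j z) ->
  exists! h : Z -> top_lim, continuous h /\ forall i z, coord (h z) i = f i z.
Proof.
move=> kZ cf fE.
have fc z : compatible (f^~ z) by move=> i j e; exact: fE.
exists (fun z => mk_lim (fc z)); split=> [|h [_ hE]]; last first.
  apply/funext => z; apply: coord_inj.
  apply: functional_extensionality_dep => i.
  by rewrite hE.
split=> //; apply/kelley_continuous => //.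
apply: continuous_comp_initial => z.
apply/cvg_sup => i U [_ [[A oA <-] /= Afz] sU].
apply: (filterS sU); apply: cf; exact: open_nbhs_nbhs.
Qed.

End Limit.

(* The pairs (x, y) with t x = s y, with the topology of the pullback in       *)
(* compactly generated spaces (not of the pullback in general spaces).         *)
Section Composable.
Variables (P : topologicalType) (A : Type) (s t : P -> A).

Definition composable : topologicalType :=
  kelley (set_type [set p : P * P | t p.1 = s p.2]).

Definition cpair x y (e : t x = s y) : composable :=
  exist _ (x, y) (@mem_set _ [set p : P * P | t p.1 = s p.2] (x, y) e).

End Composable.

Record flow := Flow {
  skel : discreteTopologicalType;
  paths : topologicalType;
  paths_cg : compactly_generated paths;
  src : paths -> skel;
  tgt : paths -> skel;
  src_continuous : continuous src;
  tgt_continuous : continuous tgt;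
  concat : composable src tgt -> paths;
  concat_continuous : continuous concat;
  src_concat : forall x y (e : tgt x = src y), src (concat (cpair e)) = src x;
  tgt_concat : forall x y (e : tgt x = src y), tgt (concat (cpair e)) = tgt y;
  concatA : forall x y z (xy : tgt x = src y) (yz : tgt y = src z)
    (xy_z : tgt (concat (cpair xy)) = src z)
    (x_yz : tgt x = src (concat (cpair yz))),
    concat (cpair xy_z) = concat (cpair x_yz) }.

Arguments src {f}.
Arguments tgt {f}.
Arguments concat {f}.

Record flow_hom (X Y : flow) := FlowHom {
  hom0 : skel X -> skel Y;
  homP : paths X -> paths Y;
  homP_continuous : continuous homP;
  hom_src : forall x, src (homP x) = hom0 (src x);
  hom_tgt : forall x, tgt (homP x) = hom0 (tgt x);
  hom_concat : forall x y (e : tgt x = src y)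
    (e' : tgt (homP x) = src (homP y)),
    homP (concat (cpair e)) = concat (cpair e') }.

HB.instance Definition _ X Y := gen_eqMixin (flow_hom X Y).
HB.instance Definition _ X Y := gen_choiceMixin (flow_hom X Y).

Lemma flow_hom_eq X Y (f g : flow_hom X Y) :
  hom0 f = hom0 g -> homP f = homP g -> f = g.
Proof.
case: f g => [f0 fP c1 s1 t1 m1] [g0 gP c2 s2 t2 m2] /= E0 EP.
case: g0 / E0 s2 t2 => s2 t2; case: gP / EP c2 s2 t2 m2 => c2 s2 t2 m2.
by congr FlowHom; exact: Prop_irrelevance.
Qed.

Section FlowCategory.
Variables X Y Z : flow.

Let id_continuous : continuous (@id (paths X)).
Proof. by move=> x U. Qed.

Let id_concat x y (e e' : tgt x = src y) :
  concat (cpair e) = concat (cpair e') :> paths X.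
Proof. by rewrite (Prop_irrelevance e e'). Qed.

Definition flow_id : flow_hom X X :=
  @FlowHom X X id id id_continuous (fun=> erefl) (fun=> erefl) id_concat.

Variables (g : flow_hom Y Z) (f : flow_hom X Y).

Let comp_continuous : continuous (homP g \o homP f).
Proof. by move=> x; apply: continuous_comp; exact: homP_continuous. Qed.

Let comp_src x : src (homP g (homP f x)) = hom0 g (hom0 f (src x)).
Proof. by rewrite !hom_src. Qed.

Let comp_tgt x : tgt (homP g (homP f x)) = hom0 g (hom0 f (tgt x)).
Proof. by rewrite !hom_tgt. Qed.

Let comp_concat x y (e : tgt x = src y)
    (e' : tgt (homP g (homP f x)) = src (homP g (homP f y))) :
  homP g (homP f (concat (cpair e))) = concat (cpair e').
Proof.
have e1 : tgt (homP f x) = src (homP f y) by rewrite hom_tgt hom_src e.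
by rewrite (@hom_concat _ _ f _ _ e e1) (@hom_concat _ _ g _ _ e1 e').
Qed.

Definition flow_comp : flow_hom X Z :=
  @FlowHom X Z (hom0 g \o hom0 f) (homP g \o homP f)
    comp_continuous comp_src comp_tgt comp_concat.

End FlowCategory.

Lemma flow_compA W X Y Z (h : flow_hom Y Z) (g : flow_hom X Y)
    (f : flow_hom W X) :
  flow_comp h (flow_comp g f) = flow_comp (flow_comp h g) f.
Proof. exact: flow_hom_eq. Qed.

Definition under_part (X : flow) (b : bool) : topologicalType :=
  if b then paths X else skel X.

Definition under (X : flow) : topologicalType := {b : bool & under_part X b}.

Definition under_map X Y (f : flow_hom X Y) (u : under X) : under Y :=
  match u with
  | existT true x => existT (under_part Y) true (homP f x)
  | existT false a => existT (under_part Y) false (hom0 f a)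
  end.

(* The compact-open topology of the library uses all quasi-compact subsets of  *)
(* the source.  Using only its compact Hausdorff subsets gives the same        *)
(* topology after Kelleyfication, as under X and under Y are compactly         *)
(* generated.                                                                  *)
Definition FLOW (X Y : flow) : topologicalType :=
  kelley (initial_topology
    (@under_map X Y : flow_hom X Y -> {compact-open, under X -> under Y})).

Definition FLOW_map X X' Y Y' (g : flow_hom X' X) (h : flow_hom Y Y')
    (f : FLOW X Y) : FLOW X' Y' :=
  flow_comp h (flow_comp f g).

Record category := Category {
  ob :> Type;
  arr : ob -> ob -> Type;
  arr_id : forall i, arr i i;
  arr_comp : forall i j k, arr j k -> arr i j -> arr i k;
  arr_comp1 : forall i j (u : arr i j), arr_comp u (arr_id i) = u;
  arr_1comp : forall i j (u : arr i j), arr_comp (arr_id j) u = u;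
  arr_compA : forall i j k l (w : arr k l) (v : arr j k) (u : arr i j),
    arr_comp w (arr_comp v u) = arr_comp (arr_comp w v) u }.

Definition finite_category (I : category) : Prop :=
  finite_set [set: I] /\ forall i j : I, finite_set [set: arr i j].

Record diagram (I : category) := Diagram {
  dob :> I -> flow;
  dmap : forall i j : I, arr i j -> flow_hom (dob i) (dob j);
  dmap_id : forall i, dmap (arr_id i) = flow_id (dob i);
  dmap_comp : forall i j k (v : arr j k) (u : arr i j),
    dmap (arr_comp v u) = flow_comp (dmap v) (dmap u) }.

Record diagram_hom (I : category) (D D' : diagram I) := DiagramHom {
  dhom :> forall i, flow_hom (D i) (D' i);
  dhom_nat : forall i j (u : arr i j),
    flow_comp (dhom j) (dmap D u) = flow_comp (dmap D' u) (dhom i) }.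

Section Cones.
Variables (I : category) (D : diagram I).

Record cocone := Cocone {
  cocone_apex : flow;
  cocone_inj : forall i, flow_hom (D i) cocone_apex;
  cocone_compat : forall i j (u : arr i j),
    flow_comp (cocone_inj j) (dmap D u) = cocone_inj i }.

Definition is_colimit (C : cocone) : Prop :=
  forall C' : cocone, exists! h : flow_hom (cocone_apex C) (cocone_apex C'),
    forall i, flow_comp h (cocone_inj C i) = cocone_inj C' i.

Record cone := Cone {
  cone_apex : flow;
  cone_prj : forall i, flow_hom cone_apex (D i);
  cone_compat : forall i j (u : arr i j),
    flow_comp (dmap D u) (cone_prj i) = cone_prj j }.

Definition is_limit (L : cone) : Prop :=
  forall L' : cone, exists! h : flow_hom (cone_apex L') (cone_apex L),
    forall i, flow_comp (cone_prj L i) h = cone_prj L' i.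

End Cones.

Section FromColimit.
Variable I : category.

(* i |-> FLOW (D i) Y is contravariant, hence the reversal of the arrows.      *)
Definition lim_FLOW_from (D : diagram I) (Y : flow) : topologicalType :=
  @top_lim I (fun i j => arr j i) (fun i => FLOW (D i) Y)
    (fun i j u => FLOW_map (dmap D u) (flow_id Y)).

Section Map.
Variables (D D' : diagram I) (Y Y' : flow).
Variables (a : diagram_hom D D') (h : flow_hom Y Y').

Let from_map_compatible (x : lim_FLOW_from D' Y) i j (u : arr j i) :
  FLOW_map (dmap D u) (flow_id Y') (FLOW_map (a i) h (coord x i))
  = FLOW_map (a j) h (coord x j).
Proof.
rewrite -(coord_compatible x u) /FLOW_map -!flow_compA dhom_nat !flow_compA.
exact: flow_hom_eq.
Qed.

Definition lim_FLOW_from_map (x : lim_FLOW_from D' Y) : lim_FLOW_from D Y' :=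
  mk_lim (from_map_compatible x).

End Map.

Section Comparison.
Variables (D : diagram I) (C : cocone D) (Y : flow).

Let colim_comparison_compatible (f : FLOW (cocone_apex C) Y) i j
    (u : arr j i) :
  FLOW_map (dmap D u) (flow_id Y) (FLOW_map (cocone_inj C i) (flow_id Y) f)
  = FLOW_map (cocone_inj C j) (flow_id Y) f.
Proof. by rewrite -(cocone_compat C u) /FLOW_map; exact: flow_hom_eq. Qed.

Definition colim_comparison (f : FLOW (cocone_apex C) Y) : lim_FLOW_from D Y :=
  mk_lim (colim_comparison_compatible f).

End Comparison.

End FromColimit.

Section ToLimit.
Variable I : category.

Definition lim_FLOW_to (X : flow) (D : diagram I) : topologicalType :=
  @top_lim I (@arr I) (fun i => FLOW X (D i))
    (fun i j u => FLOW_map (flow_id X) (dmap D u)).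

Section Map.
Variables (X X' : flow) (D D' : diagram I).
Variables (g : flow_hom X' X) (a : diagram_hom D D').

Let to_map_compatible (x : lim_FLOW_to X D) i j (u : arr i j) :
  FLOW_map (flow_id X') (dmap D' u) (FLOW_map g (a i) (coord x i))
  = FLOW_map g (a j) (coord x j).
Proof.
rewrite -(coord_compatible x u) /FLOW_map !flow_compA -dhom_nat -!flow_compA.
exact: flow_hom_eq.
Qed.

Definition lim_FLOW_to_map (x : lim_FLOW_to X D) : lim_FLOW_to X' D' :=
  mk_lim (to_map_compatible x).

End Map.

Section Comparison.
Variables (X : flow) (D : diagram I) (L : cone D).

Let lim_comparison_compatible (f : FLOW X (cone_apex L)) i j (u : arr i j) :
  FLOW_map (flow_id X) (dmap D u) (FLOW_map (flow_id X) (cone_prj L i) f)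
  = FLOW_map (flow_id X) (cone_prj L j) f.
Proof. by rewrite -(cone_compat L u) /FLOW_map; exact: flow_hom_eq. Qed.

Definition lim_comparison (f : FLOW X (cone_apex L)) : lim_FLOW_to X D :=
  mk_lim (lim_comparison_compatible f).

End Comparison.

End ToLimit.

Arguments colim_comparison {I D} C Y f.
Arguments lim_comparison {I} X {D} L f.

(* Main.v *)
Require Import Defs.
From mathcomp Require Import all_boot all_classical.
From mathcomp Require Import topology.
Set Implicit Arguments.
Unset Strict Implicit.
Unset Printing Implicit Defensive.
Local Open Scope classical_set_scope.

(** The spaces FLOW X Y, their limits and the path spaces of flows are k-spaces,
    so the continuity of a map out of them, and the closedness of a subset of
    them, can be tested along continuous maps from compact Hausdorff spaces K.
    Everything therefore comes down to understanding the continuous maps f from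
    such a K to FLOW X Y.

    The compact-open topology is exponential in the following weak sense, which
    suffices: f is continuous iff, for every compact Hausdorff M with maps p
    to K and q to the source, the map sending m to f (p m) (q m) is continuous
    (compact_open_test and compact_open_continuous).  For flows this splits into
    a condition on states and a condition on paths (FLOW_hom0_continuous,
    FLOW_homP_continuous and FLOW_continuous).  Functoriality follows at once.
    FLOW X Y is weak Hausdorff because the evaluations at the states and at the
    paths of X are continuous, jointly injective, and take values in weak
    Hausdorff spaces (weak_hausdorff_jointly_injective).

    Both comparison maps are continuous bijections, by functoriality and by the
    universal property of the (co)limit; the point is that the inverse sends a
    continuous family over K to a continuous family.

    For colimits, the continuous maps from K to FLOW X Y correspond to the
    morphisms of flows from X to the cotensor of Y by K: the flow whose states
    are the continuous maps from K to the skeleton of Y and whose paths are the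
    continuous maps from K to the paths of Y.  Its skeleton is made discrete;
    this is compatible with the source and target maps because a continuous map
    from a compact space to a discrete one is isolated in the compact-open
    topology (post_continuous).  So a compatible K-family on the diagram is a
    cocone with apex the cotensor, and the universal property of the colimit,
    applied to this one cocone, glues the whole family at once.

    For limits, the topology of the paths of the limit L must be reached through
    the universal property alone.  Given a test space M, the flow freely
    generated by M as its space of paths maps to each D i by the given family,
    and the induced morphism to L is the sought continuous map on M.  To define
    it, the source and target of the paths in L must vary continuously, i.e. be
    locally constant, on M.  They are determined by their projections to the
    skeletons of the D i, each of which is locally constant; with finitely many
    indices, so are all of them together.  Finiteness enters only there: an
    infinite product of discrete spaces need not be discrete. *)

(** * Compact Hausdorff spaces *)

Definition compact_hausdorff (K : topologicalType) : Prop :=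
  compact [set: K] /\ hausdorff_space K.

Lemma compact_hausdorff_k_space (K : topologicalType) :
  compact_hausdorff K -> k_space K.
Proof. by move=> [cK hK] A /(_ K id cK hK); apply => x. Qed.

Lemma compact_image (K T : topologicalType) (f : K -> T) (A : set K) :
  continuous f -> compact A -> compact (f @` A).
Proof. by move=> cf; apply/continuous_compact/continuous_subspaceT. Qed.

Lemma compact_hausdorff_weak_hausdorff (K : topologicalType) :
  compact_hausdorff K -> weak_hausdorff K.
Proof.
move=> [cK hK] L f cL hL cf; apply: compact_closed => //.
exact: compact_image.
Qed.

Lemma compact_hausdorff_compactly_generated (K : topologicalType) :
  compact_hausdorff K -> compactly_generated K.
Proof.
by split; [exact: compact_hausdorff_k_space
          |exact: compact_hausdorff_weak_hausdorff].
Qed.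

Lemma compact_hausdorff_prod (K L : topologicalType) :
  compact_hausdorff K -> compact_hausdorff L -> compact_hausdorff (K * L)%type.
Proof.
move=> [cK hK] [cL hL]; split; first by rewrite -setXTT; exact: compact_setX.
move=> [x1 x2] [y1 y2] xy; congr pair.
- apply: hK => A B Ax By.
  have [||] := xy (A `*` setT) (B `*` setT).
  + by exists (A, setT) => //; split=> //; exact: filterT.
  + by exists (B, setT) => //; split=> //; exact: filterT.
  by move=> [z1 z2] [[Az _] [Bz _]]; exists z1.
- apply: hL => A B Ax By.
  have [||] := xy (setT `*` A) (setT `*` B).
  + by exists (setT, A) => //; split=> //; exact: filterT.
  + by exists (setT, B) => //; split=> //; exact: filterT.
  by move=> [z1 z2] [[_ Az] [_ Bz]]; exists z2.
Qed.

Lemma set_val_continuous (T : topologicalType) (A : set T) :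
  continuous (set_val : set_type A -> T).
Proof. exact: initial_continuous. Qed.

Lemma compact_hausdorff_closed (K : topologicalType) (A : set K) :
  closed A -> compact_hausdorff K -> compact_hausdorff (set_type A).
Proof.
move=> clA [cK hK]; have cA : compact A by exact: (subclosed_compact clA cK).
split.
  move=> F PF _.
  have FA : F (set_val @^-1` A) by apply: filterE => y; exact: set_valP.
  have [x [Ax xF]] := cA _ (fmap_proper_filter set_val PF) FA.
  exists (exist _ x (mem_set Ax)); split=> // B U FB [_ [[V oV <-] /= Vx VU]].
  have [|_ [[y By <-] Vy]] := xF (set_val @` B) V _ (open_nbhs_nbhs (conj oV Vx)).
    by apply: (@filterS _ F _ B) => // y By; exists y.
  by exists y; split=> //; exact: VU.
move=> x y xy; apply: val_inj; apply: hK => U V Ux Vy.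
have [||z [Uz Vz]] := xy (set_val @^-1` U) (set_val @^-1` V).
- exact: set_val_continuous.
- exact: set_val_continuous.
by exists (set_val z).
Qed.

Lemma normal_separation (K : topologicalType) (A B : set K) :
  compact_hausdorff K -> closed A -> closed B -> A `&` B = set0 ->
  exists U V, [/\ open U, open V, A `<=` U, B `<=` V & U `&` V = set0].
Proof.
move=> [cK hK] clA clB AB0.
have [C /set_nbhsP[U [oU AU UC]] CB] : filter_from (set_nbhs A) closure (~` B).
  apply: (compact_normal hK cK clA); apply/set_nbhsP.
  exists (~` B); split=> //; first exact: closed_openC.
  exact/disjoints_subset.
exists U, (~` closure C); split=> //; first exact/closed_openC/closed_closure.
  by apply: subsetCr; exact: CB.
apply/disjoints_subset; rewrite setCK.
exact: (subset_trans UC (@subset_closure _ _)).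
Qed.

(** * Spaces tested by compact Hausdorff spaces *)

Lemma continuous_k_space (Z S : topologicalType) (g : Z -> S) :
  k_space Z ->
  (forall (K : topologicalType) (f : K -> Z),
    compact_hausdorff K -> continuous f -> continuous (g \o f)) ->
  continuous g.
Proof.
move=> kZ cg; apply/continuousP => A oA; apply: kZ => K f cK hK cf.
by have /continuousP := cg K f (conj cK hK) cf; exact.
Qed.

Lemma kelley_k_space (T : topologicalType) : k_space (kelley T).
Proof.
move=> A kA; rewrite kelley_openE => K f cK hK cf.
by apply: (kA K f cK hK); apply/kelley_continuous => //;
  exact: compact_hausdorff_k_space.
Qed.

Lemma top_lim_continuous (I : Type) (E : I -> I -> Type)
    (S : I -> topologicalType) (S_ : forall i j, E i j -> S i -> S j)
    (Z : topologicalType) (h : Z -> top_lim S_) :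
  k_space Z -> (forall i, continuous (fun z => coord (h z) i)) -> continuous h.
Proof.
move=> kZ ch.
have [|h' [[ch' h'E] _]] := top_lim_universal (S_ := S_) kZ ch.
  by move=> i j e z; exact: coord_compatible.
suff -> : h = h' by [].
apply/funext => z; apply: coord_inj; apply: functional_extensionality_dep => i.
by rewrite h'E.
Qed.

Lemma weak_hausdorff_closed_image (T K : topologicalType) (u : K -> T)
    (A : set K) :
  weak_hausdorff T -> compact_hausdorff K -> continuous u -> closed A ->
  closed (u @` A).
Proof.
move=> wT KK cu clA; have [cA hA] := compact_hausdorff_closed clA KK.
have -> : u @` A = range (u \o set_val : set_type A -> T).
  apply/seteqP; split=> [_ [x Ax <-]|_ [x _ <-]].
    by exists (exist _ x (mem_set Ax)).
  by exists (set_val x) => //; exact: set_valP.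
apply: wT => // x.
by apply: continuous_comp; [exact: set_val_continuous|exact: cu].
Qed.

Lemma weak_hausdorff_closed_point (T K : topologicalType) (u : K -> T) (x : K) :
  weak_hausdorff T -> compact_hausdorff K -> closed [set u x].
Proof.
move=> wT [cK hK]; rewrite (_ : [set u x] = range (fun _ : K => u x)).
  by apply: wT => //; exact: cst_continuous.
by apply/seteqP; split=> [_ ->|_ [_ _ <-]] //; exists x.
Qed.

(** If u x and v x differ, their fibers in K under u and under v are disjoint
    closed sets.  Separate them by open sets in K; the images of the complements
    of these are closed in T, so they cut out neighborhoods of u x and of v x
    which may meet in T, but only away from the images of u and v. *)
Lemma weak_hausdorff_closed_eq (T K : topologicalType) (u v : K -> T) :
  weak_hausdorff T -> compact_hausdorff K -> continuous u -> continuous v ->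
  closed [set x | u x = v x].
Proof.
move=> wT KK cu cv; rewrite -openC openE => x /= uvx.
have pre (w : K -> T) : continuous w ->
    closed (w @^-1` [set u x]) /\ closed (w @^-1` [set v x]).
  move=> /continuous_closedP cw.
  by split; apply: cw; exact: weak_hausdorff_closed_point.
have dis (w : K -> T) : w @^-1` [set u x] `&` w @^-1` [set v x] = set0.
  by rewrite -preimage_setI -subset0 => y /= [-> /uvx].
have [cu1 cu2] := pre u cu; have [cv1 cv2] := pre v cv.
have [U1 [U2 [oU1 oU2 sU1 sU2 U0]]] := normal_separation KK cu1 cu2 (dis u).
have [V1 [V2 [oV1 oV2 sV1 sV2 V0]]] := normal_separation KK cv1 cv2 (dis v).
(* The points of T over which the fibers of u lie in A and those of v in B. *)
pose O A B := ~` (u @` (~` A) `|` v @` (~` B)).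
have oO A B : open A -> open B -> open (O A B).
  by move=> oA oB; apply: closed_openC; apply: closedU;
    apply: weak_hausdorff_closed_image => //; exact: open_closedC.
have : nbhs x ((u @^-1` O U1 V1) `&` (v @^-1` O U2 V2)).
  apply: filterI.
    apply: cu; apply: open_nbhs_nbhs; split; first exact: oO.
    by move=> /= [[y nU1 uy]|[y nV1 vy]]; [apply/nU1/sU1|apply/nV1/sV1].
  apply: cv; apply: open_nbhs_nbhs; split; first exact: oO.
  by move=> /= [[y nU2 uy]|[y nV2 vy]]; [apply/nU2/sU2|apply/nV2/sV2].
apply: filterS => y /= [O1 O2] uvy.
have U1y : U1 y by apply: contrapT => nU1; apply: O1; left; exists y.
have V2y : V2 y by apply: contrapT => nV2; apply: O2; right; exists y.
rewrite uvy in O1.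
have V1y : V1 y by apply: contrapT => nV1; apply: O1; right; exists y.
by have : (V1 `&` V2) y by []; rewrite V0.
Qed.

(** For a map f from K to Z, tested along g from L to Z, the preimage of the
    range of f is the projection along the compact K of the set of pairs (x, y)
    with f x = g y, which is an intersection of equalizers of pairs of maps to the spaces S i. *)
Lemma weak_hausdorff_jointly_injective (Z : topologicalType) (I : Type)
    (S : I -> topologicalType) (e : forall i, Z -> S i) :
  k_space Z -> (forall i, continuous (e i)) ->
  (forall i, weak_hausdorff (S i)) ->
  (forall x y, (forall i, e i x = e i y) -> x = y) ->
  weak_hausdorff Z.
Proof.
move=> kZ ce wS einj K f cK hK cf; rewrite -openC; apply: kZ => L g cL hL cg.
have KL : compact_hausdorff (K * L)%type by exact: compact_hausdorff_prod.
rewrite preimage_setC openC.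
pose E := \bigcap_i [set p : K * L | e i (f p.1) = e i (g p.2)].
have gE : g @^-1` range f = snd @` E.
  apply/seteqP; split=> [y [x _ fx]|_ [[x y] /= xy <-]].
    by exists (x, y) => // i _ /=; rewrite fx.
  by exists x => //; apply: einj => i; exact: xy.
rewrite -[X in closed X]/(g @^-1` range f) gE.
apply: compact_closed => //; apply: compact_image.
  by move=> x; exact: cvg_snd.
apply: (subclosed_compact _ KL.1) => //.
apply: closed_bigI => i _; apply: weak_hausdorff_closed_eq => // p.
  apply: continuous_comp; [|exact: ce].
  by apply: continuous_comp; [exact: cvg_fst|exact: cf].
apply: continuous_comp; [|exact: ce].
by apply: continuous_comp; [exact: cvg_snd|exact: cg].
Qed.

(** * Discrete spaces and sums *)

Lemma discrete_continuousP (K : topologicalType) (S : discreteTopologicalType)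
  (f : K -> S) : continuous f <-> forall x, \forall y \near x, f y = f x.
Proof.
split=> cf x; first exact: cf (discrete_set1 (f x)).
by move=> A /nbhs_singleton Ax; apply: filterS (cf x) => y /= ->.
Qed.

Lemma discrete_k_space (S : discreteTopologicalType) : k_space S.
Proof. by move=> A _; exact: discrete_open. Qed.

Lemma discrete_weak_hausdorff (S : discreteTopologicalType) : weak_hausdorff S.
Proof. by move=> K f _ _ _; exact: discrete_closed. Qed.

Lemma discrete_compactly_generated (S : discreteTopologicalType) :
  compactly_generated S.
Proof. by split; [exact: discrete_k_space|exact: discrete_weak_hausdorff]. Qed.

Lemma discrete_fun_continuous (S : discreteTopologicalType) (T : topologicalType)
  (f : S -> T) : continuous f.
Proof.
by move=> x U /nbhs_singleton Ux; apply: filterS (discrete_set1 x) => y ->.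
Qed.

Lemma existT_reflects_continuous (I : choiceType) (S : I -> topologicalType) i
    (K : topologicalType) (f : K -> S i) :
  continuous (existT S i \o f) -> continuous f.
Proof.
move=> cf; apply/continuousP => A oA.
have := (continuousP _).1 cf _ (@existT_open_map _ _ i A oA).
congr open; apply/seteqP; split=> k /= => [[y Ay yE]|fA]; last by exists (f k).
by rewrite -(existT_inj2 yE).
Qed.

Lemma near_finite_forall (J T : Type) (F : set_system T) (P : J -> set T) :
  Filter F -> finite_set [set: J] -> (forall j, F (P j)) ->
  \forall x \near F, forall j, P j x.
Proof.
move=> FF /(@finite_fsetP {classic J})[A AE] FP.
have /= := @filter_bigI T {classic J} A P F FF (fun j _ => FP j).
by apply: filterS => x /= xP j; apply: xP; rewrite -AE.
Qed.

(** * The compact-open topology tested by compact Hausdorff spaces *)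

(** The tube lemma. *)
Lemma open_forall_compact (K L : topologicalType) (C : set L) (W : set (K * L)) :
  compact C -> open W -> open [set k | forall l, C l -> W (k, l)].
Proof.
move=> /compact_near_coveringP cC oW; rewrite openE => k /= Wk.
have := @cC K (nbhs k) (fun k l => W (k, l)) _; apply => l Cl.
have [[A B] /= [Ak Bl] AB] : nbhs (k, l) W.
  by apply: open_nbhs_nbhs; split=> //; exact: Wk.
by exists (B, A) => // -[l' k'] /= [Bl' Ak']; exact: (AB (k', l')).
Qed.

Lemma compact_hausdorff_regular (K : topologicalType) (x : K) (U : set K) :
  compact_hausdorff K -> nbhs x U ->
  exists N, [/\ nbhs x N, compact N & N `<=` U].
Proof.
move=> [cK hK] Ux.
have [V Vx VU] := compact_regular hK cK filterT Ux.
exists (closure V); split=> //.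
  exact: (filterS (@subset_closure _ _)).
by apply: (subclosed_compact _ cK) => //; exact: closed_closure.
Qed.

(** The composite of f (p m) with q is continuous, hence sends a compact
    neighborhood N of m into a given open O; by definition of the compact-open
    topology, the nearby maps f k still send the compact q N into O. *)
Lemma compact_open_test (K X Y M : topologicalType)
    (f : K -> {compact-open, X -> Y}) (p : M -> K) (q : M -> X) :
  compact_hausdorff M -> continuous f -> (forall k, continuous (f k : X -> Y)) ->
  continuous p -> continuous q ->
  continuous (fun m => f (p m) (q m) : Y).
Proof.
move=> MM cf cfk cp cq m B; rewrite nbhsE => -[O [oO Om] OB].
have /(compact_hausdorff_regular MM)[N [Nm cN NO]] :
    nbhs m ((f (p m) \o q) @^-1` O).
  have cfq : continuous (f (p m) \o q).
    by move=> x; apply: continuous_comp; [exact: cq|exact: cfk].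
  exact/cfq/open_nbhs_nbhs.
have pN : nbhs m (p @^-1` (f @^-1` [set h | h @` (q @` N) `<=` O])).
  apply: cp; apply: cf; apply: open_nbhs_nbhs; split.
    by apply: compact_open_open => //; exact: compact_image.
  by move=> _ [_ [x Nx <-] <-]; exact: NO.
apply: (filterS _ (filterI pN Nm)) => x /= [fx Nx]; apply: OB; apply: fx.
by exists (q x) => //; exists x.
Qed.

(** The hypothesis makes the uncurried map continuous on the product K * X,
    because the product of a compact Hausdorff space with a k-space is a k-space,
    and the tube lemma then handles every compact subset of X, whether Hausdorff
    or not.  This is why using all quasi-compact subsets in the compact-open
    topology does no harm. *)
Lemma compact_open_continuous (K X Y : topologicalType)
    (f : K -> {compact-open, X -> Y}) :
  compact_hausdorff K -> k_space X ->
  (forall (M : topologicalType) (p : M -> K) (q : M -> X),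
    compact_hausdorff M -> continuous p -> continuous q ->
    continuous (fun m => f (p m) (q m) : Y)) ->
  continuous f.
Proof.
move=> KK kX cf.
have oW (O : set Y) : open O -> open [set kx : K * X | O (f kx.1 kx.2)].
  move=> oO; rewrite openE => -[k0 x0] /= O0.
  have /(compact_hausdorff_regular KK)[N [Nk cN NO]] :
      nbhs k0 [set k | O (f k x0)].
    apply: (cf K id (fun=> x0)); last exact: open_nbhs_nbhs.
    - exact: KK.
    - by move=> x.
    - exact: cst_continuous.
  (* The second factor is open since its trace on any test space L is open,
     by the tube lemma along the compact N. *)
  exists (N, [set x | forall k, N k -> O (f k x)]); last first.
    by move=> [k x] /= [Nk1]; exact.
  split=> //=; apply: open_nbhs_nbhs; split=> //.
  apply: kX => L h cL hL ch.
  apply: (@open_forall_compact L K N [set lk | O (f lk.2 (h lk.1))]) => //.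
  have LK : compact_hausdorff (L * K)%type by exact: compact_hausdorff_prod.
  have cW : continuous (fun lk : L * K => f lk.2 (h lk.1) : Y).
    apply: (cf (L * K)%type snd (h \o fst) LK) => x; first exact: cvg_snd.
    by apply: continuous_comp; [exact: cvg_fst|exact: ch].
  exact: (continuousP _).1 cW O oO.
move=> k0; apply/compact_open_cvgP => C O cC oO CO.
have oC := open_forall_compact cC (oW O oO).
apply: (filterS _ (open_nbhs_nbhs (conj oC _) : nbhs k0 _)) => /=.
  by move=> k kC _ [x Cx <-]; exact: kC.
by move=> x Cx; apply: CO; exists x.
Qed.

(** * Compact Hausdorff families of flow morphisms *)

Lemma under_k_space (X : flow) : k_space (under X).
Proof.
move=> A kA; apply/sigT_openP => -[] /=.
  apply: (paths_cg X).1 => K f cK hK cf.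
  apply: (kA K (existT (under_part X) true \o f)) => // x.
  by apply: continuous_comp; [exact: cf|exact: existT_continuous].
exact: discrete_open.
Qed.

Section FlowTests.
Variables X Y : flow.

Lemma under_map_continuous (f : flow_hom X Y) : continuous (under_map f).
Proof.
case=> -[] x U Ux; last first.
  apply: filterS (discrete_set1 (x : skel X)) => /= y ->.
  exact: nbhs_singleton Ux.
have : nbhs (homP f x) (existT (under_part Y) true @^-1` U) by exact: Ux.
by move=> /homP_continuous.
Qed.

Lemma FLOW_under_continuous (K : topologicalType) (f : K -> FLOW X Y) :
  k_space K ->
  continuous f <->
  continuous (fun k => under_map (f k) : {compact-open, under X -> under Y}).
Proof.
move=> kK; split=> [/kelley_continuous-/(_ kK) cf k|cf].
  apply: (continuous_comp (cf k)); exact: initial_continuous.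
by apply/kelley_continuous => //; exact: continuous_comp_initial.
Qed.

Lemma FLOW_hom0_continuous (K : topologicalType) (f : K -> FLOW X Y) a :
  compact_hausdorff K -> continuous f -> continuous (fun k => hom0 (f k) a).
Proof.
move=> KK /FLOW_under_continuous-/(_ (compact_hausdorff_k_space KK)) cf.
have cu : continuous (fun k => under_map (f k) (existT (under_part X) false a)).
  apply: (compact_open_test (p := id) KK cf).
  - by move=> k; exact: under_map_continuous.
  - by move=> k.
  - exact: cst_continuous.
exact: (@existT_reflects_continuous _ (under_part Y) false).
Qed.

Lemma FLOW_homP_continuous (K M : topologicalType) (f : K -> FLOW X Y)
    (p : M -> K) (q : M -> paths X) :
  compact_hausdorff K -> compact_hausdorff M ->
  continuous f -> continuous p -> continuous q ->
  continuous (fun m => homP (f (p m)) (q m)).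
Proof.
move=> KK MM /FLOW_under_continuous-/(_ (compact_hausdorff_k_space KK)) cf cp cq.
have cu : continuous
    (fun m => under_map (f (p m)) (existT (under_part X) true (q m))).
  apply: (compact_open_test (q := existT (under_part X) true \o q) MM cf) => //.
  - by move=> k; exact: under_map_continuous.
  - move=> m; apply: continuous_comp; [exact: cq|exact: existT_continuous].
exact: (@existT_reflects_continuous _ (under_part Y) true).
Qed.

(** Near a point m, a map q from M to the disjoint union under X stays in one
    summand, which reduces the test along q to one of the two hypotheses. *)
Lemma FLOW_continuous (K : topologicalType) (f : K -> FLOW X Y) :
  compact_hausdorff K ->
  (forall a, continuous (fun k => hom0 (f k) a)) ->
  (forall (M : topologicalType) (p : M -> K) (q : M -> paths X),
    compact_hausdorff M -> continuous p -> continuous q ->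
    continuous (fun m => homP (f (p m)) (q m))) ->
  continuous f.
Proof.
move=> KK c0 cP; apply/FLOW_under_continuous.
  exact: compact_hausdorff_k_space.
apply: compact_open_continuous => // [|M p q MM cp cq m].
  exact: under_k_space.
rewrite /continuous_at; case qm : (q m) => [[] x] /=.
  (* Retracting onto the paths, with default value the path x under q m, turns q
     into a map defined on all of M; there is no need to restrict M. *)
  pose r (u : under X) : paths X := if u is existT true y then y else x.
  have cr : continuous r.
    move=> [] [] y U Uy; first exact: Uy.
    apply: filterS (discrete_set1 (y : skel X)) => z _.
    exact: nbhs_singleton Uy.
  have crq : continuous (r \o q).
    by move=> n; apply: continuous_comp; [exact: cq|exact: cr].
  have nq : \forall n \near m, (existT (under_part X) true @` setT) (q n).
    by apply: cq; rewrite qm; apply: existT_nbhs; exact: filterT.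
  move=> U Ux; have {}Ux : nbhs (homP (f (p m)) x)
    (existT (under_part Y) true @^-1` U) by exact: Ux.
  have := cP M p _ MM cp crq m; rewrite /continuous_at /r /= qm => /(_ _ Ux).
  by apply: filterS2 nq => n /= [y _ <-].
have nq : \forall n \near m, q n = existT (under_part X) false x.
  have nx : nbhs (q m) (existT (under_part X) false @` [set x]).
    by rewrite qm; apply: existT_nbhs; exact: (discrete_set1 (x : skel X)).
  have {}nx : nbhs m (q @^-1` (existT (under_part X) false @` [set x])).
    exact: cq nx.
  by apply: filterS nx => n [y -> <-].
move=> U Ux.
have c0p : continuous (fun n => hom0 (f (p n)) x).
  move=> n; apply: (@continuous_comp _ _ _ p (fun k => hom0 (f k) x)).
    exact: cp.
  exact: c0.
have c0m := (discrete_continuousP _).1 c0p m.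
suff : \forall n \near m, U (under_map (f (p n)) (q n)) by [].
by apply: filterS2 nq c0m => n -> /= ->; exact: nbhs_singleton Ux.
Qed.

End FlowTests.

(** * The functor FLOW *)

Lemma FLOW_eval0_continuous X Y (a : skel X) :
  continuous (fun f : FLOW X Y => hom0 f a).
Proof.
apply: continuous_k_space; first exact: kelley_k_space.
by move=> K f KK cf; exact: FLOW_hom0_continuous.
Qed.

Lemma FLOW_evalP_continuous X Y (x : paths X) :
  continuous (fun f : FLOW X Y => homP f x).
Proof.
apply: continuous_k_space; first exact: kelley_k_space.
move=> K f KK cf; apply: (@FLOW_homP_continuous _ _ K K f id (fun=> x)) => //.
  by move=> ?.
exact: cst_continuous.
Qed.

Lemma FLOW_compactly_generated X Y : compactly_generated (FLOW X Y).
Proof.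
split; first exact: kelley_k_space.
pose S (u : skel X + paths X) : topologicalType :=
  if u is inl _ then skel Y else paths Y.
pose e (u : skel X + paths X) : FLOW X Y -> S u :=
  match u with inl a => fun f => hom0 f a | inr x => fun f => homP f x end.
apply: (@weak_hausdorff_jointly_injective _ _ S e); first exact: kelley_k_space.
- by case=> [a|x]; [exact: FLOW_eval0_continuous|exact: FLOW_evalP_continuous].
- by case=> [a|x]; [exact: discrete_weak_hausdorff|exact: (paths_cg Y).2].
- move=> f g fg; apply: flow_hom_eq; apply/funext => z.
    exact: (fg (inl z)).
  exact: (fg (inr z)).
Qed.

Lemma FLOW_map_continuous (X X' Y Y' : flow) (g : flow_hom X' X)
  (h : flow_hom Y Y') : continuous (FLOW_map g h : FLOW X Y -> FLOW X' Y').
Proof.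
apply: continuous_k_space => [|K f KK cf]; first exact: kelley_k_space.
apply: FLOW_continuous => // [a|M p q MM cp cq m] /=.
  have c0 := FLOW_hom0_continuous (a := hom0 g a) KK cf.
  move=> k.
  apply: (@continuous_comp _ _ _ (fun k => hom0 (f k) (hom0 g a)) (hom0 h)).
    exact: c0.
  exact: discrete_fun_continuous.
apply: (@continuous_comp _ _ _
  (fun m => homP (f (p m)) (homP g (q m))) (homP h)).
  apply: (FLOW_homP_continuous (q := homP g \o q) KK MM cf cp) => n.
  by apply: continuous_comp; [exact: cq|exact: homP_continuous].
exact: homP_continuous.
Qed.

Lemma FLOW_map1 X Y (f : FLOW X Y) : FLOW_map (flow_id X) (flow_id Y) f = f.
Proof. exact: flow_hom_eq. Qed.

Lemma flow_1comp X Y (f : flow_hom X Y) : flow_comp (flow_id Y) f = f.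
Proof. exact: flow_hom_eq. Qed.

(** * Mapping spaces *)

Definition continuous_maps (K T : topologicalType) :
    set {compact-open, K -> T} :=
  [set f | continuous (f : K -> T)].

Arguments continuous_maps : clear implicits.

(** The internal hom from K to T in compactly generated spaces, at least for K
    compact Hausdorff. *)
Definition map_space (K T : topologicalType) : topologicalType :=
  kelley (set_type (continuous_maps K T)).

Definition map_space_fun (K T : topologicalType) (f : map_space K T) : K -> T :=
  set_val (f : set_type (continuous_maps K T)).

Definition mk_map_space (K T : topologicalType) (f : K -> T) (cf : continuous f) :
  map_space K T := exist _ f (mem_set (cf : continuous_maps K T f)).

Lemma map_space_fun_continuous (K T : topologicalType) (f : map_space K T) :
  continuous (map_space_fun f).
Proof. exact: (set_mem (valP (f : set_type (continuous_maps K T)))). Qed.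

Lemma map_space_fun_inj (K T : topologicalType) : injective (@map_space_fun K T).
Proof. exact: val_inj. Qed.

Lemma map_space_test (K T L M : topologicalType) (f : L -> map_space K T)
    (p : M -> L) (q : M -> K) :
  compact_hausdorff L -> compact_hausdorff M ->
  continuous f -> continuous p -> continuous q ->
  continuous (fun m => map_space_fun (f (p m)) (q m)).
Proof.
move=> LL MM /kelley_continuous-/(_ (compact_hausdorff_k_space LL)) cf cp cq.
apply: (compact_open_test (f := fun l => map_space_fun (f l)) MM) => //.
  move=> l; apply: (continuous_comp (cf l)); exact: set_val_continuous.
by move=> l; exact: map_space_fun_continuous.
Qed.

Lemma map_space_continuous (K T Z : topologicalType) (f : Z -> map_space K T) :
  compact_hausdorff K -> k_space Z ->
  (forall (M : topologicalType) (p : M -> Z) (q : M -> K),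
    compact_hausdorff M -> continuous p -> continuous q ->
    continuous (fun m => map_space_fun (f (p m)) (q m))) ->
  continuous f.
Proof.
move=> KK kZ cf; apply: continuous_k_space => // L g LL cg.
apply/kelley_continuous; first exact: compact_hausdorff_k_space.
apply: continuous_comp_initial; apply: compact_open_continuous => //.
  exact: compact_hausdorff_k_space.
move=> M p q MM cp cq; apply: (cf M (g \o p) q) => // m.
by apply: continuous_comp; [exact: cp|exact: cg].
Qed.

Lemma map_space_eval_continuous (K T : topologicalType) (k : K) :
  continuous (fun f : map_space K T => map_space_fun f k).
Proof.
apply: continuous_k_space; first exact: kelley_k_space.
move=> L f LL cf.
apply: (map_space_test (p := id) (q := fun=> k) LL LL cf) => //.
  by move=> ?.
exact: cst_continuous.
Qed.

Lemma map_space_compactly_generated (K T : topologicalType) :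
  weak_hausdorff T -> compactly_generated (map_space K T).
Proof.
move=> wT; split; first exact: kelley_k_space.
apply: (@weak_hausdorff_jointly_injective _ K (fun=> T)
  (fun k f => map_space_fun f k)) => //.
- exact: kelley_k_space.
- exact: map_space_eval_continuous.
- by move=> f g fg; apply: map_space_fun_inj; apply/funext.
Qed.

(** * The cotensor of a flow by a compact Hausdorff space *)

Section CpairContinuous.
Variables (P Z : topologicalType) (A : Type) (s t : P -> A).

Lemma cpair_continuous (u v : Z -> P) (e : forall z, t (u z) = s (v z)) :
  k_space Z -> continuous u -> continuous v ->
  continuous (fun z => cpair (e z)).
Proof.
move=> kZ cu cv; apply/kelley_continuous => //.
apply: continuous_comp_initial => z.
by apply: cvg_pair; [exact: cu|exact: cv].
Qed.

Lemma composable_val_continuous :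
  continuous (fun c : composable s t => val (c : set_type _) : P * P).
Proof.
apply: continuous_k_space; first exact: kelley_k_space.
move=> K f KK /kelley_continuous-/(_ (compact_hausdorff_k_space KK)) cf k.
apply: (continuous_comp (cf k)); exact: set_val_continuous.
Qed.

End CpairContinuous.

Section Cotensor.
Variables (K : topologicalType) (KK : compact_hausdorff K) (Y : flow).

(** A separate copy of the set of continuous maps, with the discrete topology,
    since the skeleton of a flow has to be discrete. *)
Definition cotensor_skel : discreteTopologicalType :=
  discrete_topology (set_type (continuous_maps K (skel Y))).

Definition skel_fun (a : cotensor_skel) : K -> skel Y :=
  set_val (a : set_type (continuous_maps K (skel Y))).

Definition mk_skel (f : K -> skel Y) (cf : continuous f) : cotensor_skel :=
  exist _ f (mem_set (cf : continuous_maps K (skel Y) f)).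

Lemma skel_fun_continuous a : continuous (skel_fun a).
Proof. exact: (set_mem (valP (a : set_type (continuous_maps K (skel Y))))). Qed.

Lemma skel_fun_inj : injective skel_fun.
Proof. exact: val_inj. Qed.

Section Post.
Variables (g : paths Y -> skel Y) (cg : continuous g).

Let post_subproof (f : map_space K (paths Y)) : continuous (g \o map_space_fun f).
Proof.
move=> k; apply: continuous_comp; [exact: map_space_fun_continuous|exact: cg].
Qed.

Definition post (f : map_space K (paths Y)) : cotensor_skel :=
  mk_skel (@post_subproof f).

(** Two continuous maps from L * K to a discrete space agree on an open set, so
    by compactness of K the l' such that g composed with f l' equals g composed
    with f l on all of K form a neighborhood of l. *)
Lemma post_continuous : continuous post.
Proof.
apply: continuous_k_space => [|L f LL cf]; first exact: kelley_k_space.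
apply/discrete_continuousP => l.
pose W := [set lk : L * K |
  g (map_space_fun (f lk.1) lk.2) = g (map_space_fun (f l) lk.2)].
have cgf : continuous (fun lk : L * K => g (map_space_fun (f lk.1) lk.2)).
  move=> lk; apply: (@continuous_comp _ _ _
    (fun lk => map_space_fun (f lk.1) lk.2) g).
    apply: (map_space_test LL _ cf) => [|x|x].
    - exact: compact_hausdorff_prod.
    - exact: cvg_fst.
    - exact: cvg_snd.
  exact: cg.
have cgl : continuous (fun lk : L * K => g (map_space_fun (f l) lk.2)).
  move=> lk; apply: (@continuous_comp _ _ _ snd (g \o map_space_fun (f l))).
    exact: cvg_snd.
  exact: post_subproof.
have oW : open W.
  rewrite openE => lk Wlk.
  have := (discrete_continuousP _).1 cgl lk.
  have := (discrete_continuousP _).1 cgf lk.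
  by apply: filterS2 => x /= xE xlE; rewrite /W /= xE xlE.
have oV := open_forall_compact KK.1 oW.
have Vl : nbhs l [set l | forall k, [set: K] k -> W (l, k)].
  by apply: open_nbhs_nbhs; split.
apply: filterS Vl => l' /= Vl'.
by apply: skel_fun_inj; apply/funext => k; exact: (Vl' k).
Qed.

End Post.

Definition cotensor_src := post (@src_continuous Y).
Definition cotensor_tgt := post (@tgt_continuous Y).

Section Concat.
Variable c : composable cotensor_src cotensor_tgt.

Definition fst_path : map_space K (paths Y) :=
  (val (c : set_type [set p | cotensor_tgt p.1 = cotensor_src p.2])).1.
Definition snd_path : map_space K (paths Y) :=
  (val (c : set_type [set p | cotensor_tgt p.1 = cotensor_src p.2])).2.

Lemma path_composable k :
  tgt (map_space_fun fst_path k) = src (map_space_fun snd_path k).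
Proof.
have := set_mem (valP
  (c : set_type [set p | cotensor_tgt p.1 = cotensor_src p.2])).
by move=> /(congr1 (skel_fun^~ k)).
Qed.

Let concat_subproof : continuous (fun k => concat (cpair (path_composable k))).
Proof.
move=> k.
apply: (@continuous_comp _ _ _ (fun k => cpair (path_composable k)) concat).
  apply: cpair_continuous; first exact: compact_hausdorff_k_space.
  - exact: map_space_fun_continuous.
  - exact: map_space_fun_continuous.
exact: concat_continuous.
Qed.

Definition cotensor_concat : map_space K (paths Y) := mk_map_space concat_subproof.

Lemma cotensor_concatE k
    (e : tgt (map_space_fun fst_path k) = src (map_space_fun snd_path k)) :
  map_space_fun cotensor_concat k = concat (cpair e).
Proof. by rewrite (Prop_irrelevance e (path_composable k)). Qed.

End Concat.

Lemma cotensor_concat_continuous : continuous cotensor_concat.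
Proof.
apply: map_space_continuous => //; first exact: kelley_k_space.
move=> M p q MM cp cq m.
pose e m := path_composable (p m) (q m).
apply: (@continuous_comp _ _ _ (fun m => cpair (e m)) concat);
  last exact: concat_continuous.
have cpv : continuous (fun m =>
    val (p m : set_type [set p | cotensor_tgt p.1 = cotensor_src p.2])).
  move=> n; apply: (continuous_comp (cp n)).
  exact: composable_val_continuous.
apply: cpair_continuous; first exact: compact_hausdorff_k_space.
- apply: (map_space_test (f := fst_path \o p) (p := id) MM MM _ _ cq) => x //.
  exact: continuous_comp (cpv x) cvg_fst.
- apply: (map_space_test (f := snd_path \o p) (p := id) MM MM _ _ cq) => x //.
  exact: continuous_comp (cpv x) cvg_snd.
Qed.

Lemma cotensor_src_concat x y (e : cotensor_tgt x = cotensor_src y) :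
  cotensor_src (cotensor_concat (cpair e)) = cotensor_src x.
Proof. by apply: skel_fun_inj; apply/funext => k; exact: src_concat. Qed.

Lemma cotensor_tgt_concat x y (e : cotensor_tgt x = cotensor_src y) :
  cotensor_tgt (cotensor_concat (cpair e)) = cotensor_tgt y.
Proof. by apply: skel_fun_inj; apply/funext => k; exact: tgt_concat. Qed.

Lemma cotensor_concatA x y z
    (xy : cotensor_tgt x = cotensor_src y) (yz : cotensor_tgt y = cotensor_src z)
    (xy_z : cotensor_tgt (cotensor_concat (cpair xy)) = cotensor_src z)
    (x_yz : cotensor_tgt x = cotensor_src (cotensor_concat (cpair yz))) :
  cotensor_concat (cpair xy_z) = cotensor_concat (cpair x_yz).
Proof. by apply: map_space_fun_inj; apply/funext => k; exact: concatA. Qed.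

(** The power of Y by K in the category of flows enriched in spaces. *)
Definition cotensor : flow :=
  @Flow cotensor_skel (map_space K (paths Y))
    (@map_space_compactly_generated K (paths Y) (paths_cg Y).2)
    cotensor_src cotensor_tgt
    (@post_continuous _ (@src_continuous Y))
    (@post_continuous _ (@tgt_continuous Y))
    cotensor_concat cotensor_concat_continuous cotensor_src_concat
    cotensor_tgt_concat cotensor_concatA.

Lemma cotensor_eval_concat k (x y : paths cotensor) (e : tgt x = src y)
    (e' : tgt (map_space_fun x k) = src (map_space_fun y k)) :
  map_space_fun (concat (cpair e)) k = concat (cpair e').
Proof. exact: cotensor_concatE. Qed.

Definition cotensor_eval (k : K) : flow_hom cotensor Y :=
  @FlowHom cotensor Y (fun a => skel_fun a k) (fun f => map_space_fun f k)
    (@map_space_eval_continuous K (paths Y) k) (fun=> erefl) (fun=> erefl)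
    (@cotensor_eval_concat k).

Variable X : flow.

(** One half of the adjunction: morphisms from X to the cotensor are continuous
    K-families of morphisms from X to Y.  The other half is transpose below. *)
Lemma untranspose_continuous (h : flow_hom X cotensor) :
  continuous (fun k => flow_comp (cotensor_eval k) h : FLOW X Y).
Proof.
apply: FLOW_continuous => // [a|M p q MM cp cq].
  exact: skel_fun_continuous.
apply: (map_space_test (f := homP h \o q) (p := id) MM MM _ _ cp) => m //.
by apply: continuous_comp; [exact: cq|exact: (@homP_continuous _ _ h)].
Qed.

Variables (f : K -> FLOW X Y) (cf : continuous f).

Definition transpose0 (a : skel X) : cotensor_skel :=
  mk_skel (FLOW_hom0_continuous (a := a) KK cf).

Let transposeP_subproof (x : paths X) : continuous (fun k => homP (f k) x).
Proof.
apply: (@FLOW_homP_continuous _ _ K K f id (fun=> x)) => //.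
  by move=> ?.
exact: cst_continuous.
Qed.

Definition transposeP (x : paths X) : map_space K (paths Y) :=
  mk_map_space (@transposeP_subproof x).

Let transposeP_continuous : continuous transposeP.
Proof.
apply: map_space_continuous => // [|M p q MM cp cq].
  exact: (paths_cg X).1.
exact: FLOW_homP_continuous KK MM cf cq cp.
Qed.

Let transpose_src x : cotensor_src (transposeP x) = transpose0 (src x).
Proof. by apply: skel_fun_inj; apply/funext => k; exact: hom_src. Qed.

Let transpose_tgt x : cotensor_tgt (transposeP x) = transpose0 (tgt x).
Proof. by apply: skel_fun_inj; apply/funext => k; exact: hom_tgt. Qed.

Let transpose_concat x y (e : tgt x = src y)
    (e' : cotensor_tgt (transposeP x) = cotensor_src (transposeP y)) :
  transposeP (concat (cpair e)) = cotensor_concat (cpair e').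
Proof. by apply: map_space_fun_inj; apply/funext => k; exact: hom_concat. Qed.

Definition transpose : flow_hom X cotensor :=
  @FlowHom X cotensor transpose0 transposeP transposeP_continuous
    transpose_src transpose_tgt transpose_concat.

Lemma transposeK k : flow_comp (cotensor_eval k) transpose = f k.
Proof. exact: flow_hom_eq. Qed.

End Cotensor.

Lemma cotensor_hom_eq (K : topologicalType) (KK : compact_hausdorff K)
    (X Y : flow) (h h' : flow_hom X (cotensor KK Y)) :
  (forall k, flow_comp (cotensor_eval KK Y k) h
             = flow_comp (cotensor_eval KK Y k) h') ->
  h = h'.
Proof.
move=> hh'; apply: flow_hom_eq; apply/funext => x.
  apply: skel_fun_inj; apply/funext => k.
  by have /(congr1 (fun g => hom0 g x)) := hh' k.
apply: map_space_fun_inj; apply/funext => k.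
by have /(congr1 (fun g => homP g x)) := hh' k.
Qed.

(** * Colimits in the first variable *)

Section FromColimit.
Variables (I : category) (D : diagram I) (C : cocone D) (Y : flow).
Hypothesis colimC : is_colimit C.

Lemma colim_hom_eq (f g : flow_hom (cocone_apex C) Y) :
  (forall i, flow_comp f (cocone_inj C i) = flow_comp g (cocone_inj C i)) ->
  f = g.
Proof.
move=> fg.
have compat i j (u : arr i j) :
    flow_comp (flow_comp g (cocone_inj C j)) (dmap D u)
    = flow_comp g (cocone_inj C i).
  by rewrite -flow_compA cocone_compat.
have [h [_ hU]] := colimC (Cocone compat).
by rewrite -(hU f) // -(hU g).
Qed.

Lemma lim_from_compat (y : lim_FLOW_from D Y) i j (u : arr i j) :
  flow_comp (coord y j) (dmap D u) = coord y i.
Proof. by rewrite -(coord_compatible y u) /FLOW_map flow_1comp. Qed.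

(** The inverse g glues a compatible family of morphisms.  For its continuity
    along y from K, transpose the families coord (y _) i to a cocone with apex
    the cotensor by K: the morphism that it induces is a continuous K-family,
    which agrees with g at each point of K by uniqueness. *)
Lemma colim_comparison_homeomorphism : homeomorphism (colim_comparison C Y).
Proof.
have glue (y : lim_FLOW_from D Y) : {h : flow_hom (cocone_apex C) Y |
    forall i, flow_comp h (cocone_inj C i) = coord y i}.
  apply: cid; have [h [hE _]] := colimC (Cocone (lim_from_compat y)).
  by exists h.
pose g y : FLOW (cocone_apex C) Y := sval (glue y).
have gE y i : flow_comp (g y) (cocone_inj C i) = coord y i := svalP (glue y) i.
split; last exists g.
  apply: top_lim_continuous => [|i]; first exact: kelley_k_space.
  exact: FLOW_map_continuous.
split=> [|f|y].
- apply: continuous_k_space => [|K y KK cy]; first exact: kelley_k_space.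
  have cyi i : continuous (fun k => coord (y k) i : FLOW (D i) Y).
    move=> k; apply: (@continuous_comp _ _ _ y (fun z => coord z i)).
      exact: cy.
    exact: coord_continuous.
  have compat i j (u : arr i j) :
      flow_comp (transpose KK (cyi j)) (dmap D u) = transpose KK (cyi i).
    apply: cotensor_hom_eq => k.
    by rewrite flow_compA !transposeK lim_from_compat.
  have [h [hE _]] := colimC (Cocone compat).
  rewrite (_ : g \o y = fun k => flow_comp (cotensor_eval KK Y k) h).
    exact: untranspose_continuous.
  apply/funext => k; apply: colim_hom_eq => i.
  by rewrite /= gE -flow_compA hE transposeK.
- by apply: colim_hom_eq => i; rewrite gE; exact: flow_1comp.
- apply: coord_inj; apply: functional_extensionality_dep => i.
  by rewrite -(gE y i); exact: flow_1comp.
Qed.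

End FromColimit.

(** * Finite limits in the second variable *)

(** The flow freely generated by a space M of paths with prescribed end points,
    when no two of them compose.  Concatenation then has an empty domain, and
    the first projection is just some continuous map defined on it. *)
Section Free.
Variables (M : topologicalType) (cgM : compactly_generated M).
Variables (S : discreteTopologicalType) (s t : M -> S).
Hypotheses (cs : continuous s) (ct : continuous t).
Hypothesis st : forall x y, t x <> s y.

Definition free_concat (c : composable s t) : M :=
  (val (c : set_type [set p : M * M | t p.1 = s p.2])).1.

Let free_concat_continuous : continuous free_concat.
Proof.
move=> c; apply: continuous_comp; last exact: cvg_fst.
exact: composable_val_continuous.
Qed.

Let free_src x y (e : t x = s y) : s (free_concat (cpair e)) = s x.
Proof. by []. Qed.

Let free_tgt x y (e : t x = s y) : t (free_concat (cpair e)) = t y.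
Proof. by case: (st e). Qed.

Let free_concatA x y z (xy : t x = s y) (yz : t y = s z)
    (xy_z : t (free_concat (cpair xy)) = s z)
    (x_yz : t x = s (free_concat (cpair yz))) :
  free_concat (cpair xy_z) = free_concat (cpair x_yz).
Proof. by []. Qed.

Definition free_flow : flow :=
  @Flow S M cgM s t cs ct free_concat free_concat_continuous
    free_src free_tgt free_concatA.

Variables (X : flow) (f0 : S -> skel X) (fP : M -> paths X).
Hypotheses (cf : continuous fP) (fs : forall x, src (fP x) = f0 (s x)).
Hypothesis ft : forall x, tgt (fP x) = f0 (t x).

Let free_hom_concat x y (e : t x = s y) (e' : tgt (fP x) = src (fP y)) :
  fP (free_concat (cpair e)) = concat (cpair e').
Proof. by case: (st e). Qed.

Definition free_hom : flow_hom free_flow X :=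
  @FlowHom free_flow X f0 fP cf fs ft free_hom_concat.

End Free.

Section ToLimit.
Variables (I : category) (D : diagram I) (L : cone D).
Hypothesis limL : is_limit L.

Lemma lim_hom_eq X (f g : flow_hom X (cone_apex L)) :
  (forall i, flow_comp (cone_prj L i) f = flow_comp (cone_prj L i) g) ->
  f = g.
Proof.
move=> fg.
have compat i j (u : arr i j) :
    flow_comp (dmap D u) (flow_comp (cone_prj L i) g)
    = flow_comp (cone_prj L j) g.
  by rewrite flow_compA cone_compat.
have [h [_ hU]] := limL (Cone compat).
by rewrite -(hU f) // -(hU g).
Qed.

(** States of a flow are the morphisms from the flow with one state and no
    paths. *)
Lemma lim_skel_eq (a b : skel (cone_apex L)) :
  (forall i, hom0 (cone_prj L i) a = hom0 (cone_prj L i) b) -> a = b.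
Proof.
move=> ab; pose V : discreteTopologicalType := discrete_topology void.
pose U : discreteTopologicalType := discrete_topology unit.
pose v : V -> U := fun x => match (x : void) with end.
pose w : V -> paths (cone_apex L) := fun x => match (x : void) with end.
have nv (x y : V) : v x <> v y by case: x.
pose pt c := @free_hom V (discrete_compactly_generated V) U v v
  (@discrete_fun_continuous _ _ v) (@discrete_fun_continuous _ _ v) nv
  (cone_apex L) (fun=> c) w (@discrete_fun_continuous _ _ w)
  (fun x => match (x : void) with end) (fun x => match (x : void) with end).
suff : pt a = pt b by move=> /(congr1 (@hom0 _ _))/(congr1 (@^~ tt)).
by apply: lim_hom_eq => i; apply: flow_hom_eq; apply/funext => -[] /=.
Qed.

(** Paths of a flow are the morphisms from the flow with two states and a single
    path from one to the other. *)
Lemma lim_paths_eq (x y : paths (cone_apex L)) :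
  (forall i, homP (cone_prj L i) x = homP (cone_prj L i) y) -> x = y.
Proof.
move=> xy; pose U : discreteTopologicalType := discrete_topology unit.
pose B : discreteTopologicalType := discrete_topology bool.
pose s (_ : U) : B := false; pose t (_ : U) : B := true.
have ts (u v : U) : t u <> s v by [].
pose arrow z := @free_hom U (discrete_compactly_generated U) B s t
  (@discrete_fun_continuous _ _ s) (@discrete_fun_continuous _ _ t) ts
  (cone_apex L) (fun b => if b then tgt z else src z)
  (fun=> z) (@discrete_fun_continuous _ _ _) (fun=> erefl) (fun=> erefl).
suff : arrow x = arrow y by move=> /(congr1 (@homP _ _))/(congr1 (@^~ tt)).
apply: lim_hom_eq => i; apply: flow_hom_eq; apply/funext => b /=; last exact: xy.
by case: b; rewrite -?hom_tgt -?hom_src xy.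
Qed.

Lemma lim_to_compat X (y : lim_FLOW_to X D) i j (u : arr i j) :
  flow_comp (dmap D u) (coord y i) = coord y j.
Proof. by rewrite -(coord_compatible y u) /FLOW_map; exact: flow_hom_eq. Qed.

Hypothesis finI : finite_category I.

(** With g the inverse, and y a continuous family of points of the limit over K,
    the states of g (y k) vary locally constantly in k because finitely many
    projections do; the paths are handled by the flow freely generated by the
    test space M. *)
Lemma lim_comparison_homeomorphism X : homeomorphism (lim_comparison X L).
Proof.
have glue (y : lim_FLOW_to X D) : {h : flow_hom X (cone_apex L) |
    forall i, flow_comp (cone_prj L i) h = coord y i}.
  apply: cid; have [h [hE _]] := limL (Cone (lim_to_compat y)).
  by exists h.
pose g y : FLOW X (cone_apex L) := sval (glue y).
have gE y i : flow_comp (cone_prj L i) (g y) = coord y i := svalP (glue y) i.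
have g0 y i a : hom0 (cone_prj L i) (hom0 (g y) a) = hom0 (coord y i) a.
  by rewrite -gE.
have gP y i x : homP (cone_prj L i) (homP (g y) x) = homP (coord y i) x.
  by rewrite -gE.
split; last exists g.
  apply: top_lim_continuous => [|i]; first exact: kelley_k_space.
  exact: FLOW_map_continuous.
split=> [|f|y]; last first.
- apply: coord_inj; apply: functional_extensionality_dep => i.
  by rewrite -(gE y i); exact: flow_hom_eq.
- by apply: lim_hom_eq => i; rewrite gE; exact: flow_hom_eq.
apply: continuous_k_space => [|K y KK cy]; first exact: kelley_k_space.
have cyi i : continuous (fun k => coord (y k) i : FLOW X (D i)).
  move=> k; apply: (@continuous_comp _ _ _ y (fun z => coord z i)).
    exact: cy.
  exact: coord_continuous.
have cg0 a : continuous (fun k => hom0 (g (y k)) a).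
  apply/discrete_continuousP => k.
  have : \forall k' \near k, forall i,
      hom0 (coord (y k') i) a = hom0 (coord (y k) i) a.
    apply: near_finite_forall finI.1 _ => i.
    have ci := FLOW_hom0_continuous (a := a) KK (cyi i).
    exact: (discrete_continuousP _).1 ci k.
  by apply: filterS => k' kk'; apply: lim_skel_eq => i; rewrite !g0.
apply: FLOW_continuous => // M p q MM cp cq.
have cg0q (e : paths X -> skel X) : continuous e ->
    continuous (fun m => hom0 (g (y (p m))) (e (q m))).
  move=> ce; apply/discrete_continuousP => m.
  have e1 : \forall n \near m, e (q n) = e (q m).
    exact: cq (ce _ _ (discrete_set1 (e (q m)))).
  have g1 : \forall n \near m,
      hom0 (g (y (p n))) (e (q m)) = hom0 (g (y (p m))) (e (q m)).
    exact: cp (cg0 _ _ _ (discrete_set1 _)).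
  by apply: filterS2 e1 g1 => n ->.
(* The states are those of the limit, doubled so that no target is a source:
   this keeps the paths in M from composing. *)
pose S : discreteTopologicalType :=
  discrete_topology (bool * skel (cone_apex L))%type.
pose s m : S := (false, hom0 (g (y (p m))) (src (q m))).
pose t m : S := (true, hom0 (g (y (p m))) (tgt (q m))).
have cs : continuous s.
  have := cg0q _ (@src_continuous X); move/discrete_continuousP => c.
  by apply/discrete_continuousP => m; apply: filterS (c m) => n nE; rewrite /s nE.
have ct : continuous t.
  have := cg0q _ (@tgt_continuous X); move/discrete_continuousP => c.
  by apply/discrete_continuousP => m; apply: filterS (c m) => n nE; rewrite /t nE.
have ts m n : t m <> s n by [].
have cP i := FLOW_homP_continuous KK MM (cyi i) cp cq.
have prs i m :
    src (homP (coord (y (p m)) i) (q m)) = hom0 (cone_prj L i) (s m).2.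
  by rewrite hom_src g0.
have prt i m :
    tgt (homP (coord (y (p m)) i) (q m)) = hom0 (cone_prj L i) (t m).2.
  by rewrite hom_tgt g0.
pose pr i := @free_hom M (compact_hausdorff_compactly_generated MM) S s t
  cs ct ts (D i) (fun a => hom0 (cone_prj L i) a.2) _ (cP i) (prs i) (prt i).
have compat i j (u : arr i j) : flow_comp (dmap D u) (pr i) = pr j.
  apply: flow_hom_eq; apply/funext => z /=.
    by rewrite -(cone_compat L u).
  by rewrite -(lim_to_compat _ u).
have [h [hE _]] := limL (Cone compat).
rewrite (_ : (fun m => _) = homP h); first exact: (@homP_continuous _ _ h).
apply/funext => m; apply: lim_paths_eq => i; rewrite /= gP.
by have /(congr1 (@homP _ _))/(congr1 (@^~ m)) := hE i.
Qed.

End ToLimit.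

(** * The theorem *)

Theorem theorem5p10 :
  (* FLOW is a functor to compactly generated spaces, contravariant in the
     first variable and covariant in the second one *)
  [/\ forall X Y : flow, compactly_generated (FLOW X Y),
      forall (X X' Y Y' : flow) (g : flow_hom X' X) (h : flow_hom Y Y'),
        continuous (FLOW_map g h : FLOW X Y -> FLOW X' Y'),
      forall (X Y : flow) (f : FLOW X Y),
        FLOW_map (flow_id X) (flow_id Y) f = f
    & forall (X X' X'' Y Y' Y'' : flow)
        (g : flow_hom X' X) (g' : flow_hom X'' X')
        (h : flow_hom Y Y') (h' : flow_hom Y' Y'') (f : FLOW X Y),
        FLOW_map (flow_comp g g') (flow_comp h' h) f
        = FLOW_map g' h' (FLOW_map g h f)]
  /\
  (* (1) colimits in the first variable *)
  ((forall (I : category) (D : diagram I) (C : cocone D),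
      is_colimit C ->
      forall Y : flow, homeomorphism (colim_comparison C Y)) /\
   (forall (I : category) (D D' : diagram I) (C : cocone D) (C' : cocone D'),
      is_colimit C -> is_colimit C' ->
      forall (a : diagram_hom D D')
        (c : flow_hom (cocone_apex C) (cocone_apex C')),
      (forall i : I, flow_comp c (cocone_inj C i) = flow_comp (cocone_inj C' i) (a i)) ->
      forall (Y Y' : flow) (h : flow_hom Y Y') (f : FLOW (cocone_apex C') Y),
        colim_comparison C Y' (FLOW_map c h f)
        = lim_FLOW_from_map a h (colim_comparison C' Y f)))
  /\
  (* (2) finite limits in the second variable *)
  ((forall (I : category) (D : diagram I) (L : cone D),
      finite_category I -> is_limit L ->
      forall X : flow, homeomorphism (lim_comparison X L)) /\
   (forall (I : category) (D D' : diagram I) (L : cone D) (L' : cone D'),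
      finite_category I -> is_limit L -> is_limit L' ->
      forall (a : diagram_hom D D')
        (l : flow_hom (cone_apex L) (cone_apex L')),
      (forall i : I, flow_comp (cone_prj L' i) l = flow_comp (a i) (cone_prj L i)) ->
      forall (X X' : flow) (g : flow_hom X' X) (f : FLOW X (cone_apex L)),
        lim_comparison X' L' (FLOW_map g l f)
        = lim_FLOW_to_map g a (lim_comparison X L f))).
Proof.
split; [split|split; split].
- exact: FLOW_compactly_generated.
- exact: FLOW_map_continuous.
- exact: FLOW_map1.
- by move=> *; exact: flow_hom_eq.
- by move=> I D C colimC Y; exact: colim_comparison_homeomorphism.
- move=> I D D' C C' _ _ a c ca Y Y' h f.
  apply: coord_inj; apply: functional_extensionality_dep => i.
  transitivity (flow_comp h (flow_comp f (flow_comp c (cocone_inj C i)))).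
    exact: flow_hom_eq.
  by rewrite ca; exact: flow_hom_eq.
- by move=> I D L finI limL X; exact: lim_comparison_homeomorphism.
- move=> I D D' L L' _ _ _ a l la X X' g f.
  apply: coord_inj; apply: functional_extensionality_dep => i.
  transitivity (flow_comp (flow_comp (cone_prj L' i) l) (flow_comp f g)).
    exact: flow_hom_eq.
  by rewrite la; exact: flow_hom_eq.
Qed.
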